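(* Let $(G,R)$ be any rooted graph and let $v\in VG$ be any vertex with $v\neq R$ and $o^{-1}(v)\cap t^{-1}(v)=\emptyset$ (no loops at $v$). Let $G_v$ be the graph obtained from $G$ by vanishing the vertex $v$. Then $$\mathcal{HT}\big(\mathcal{T}(G,R)\big)\cong \mathcal{HT}\big(\mathcal{T}(G_v,R)\big).$$
   Context: Graphs are directed with multiple edges and loops allowed: $G=(VG,EG,o,t)$ with origin and terminus maps $o,t:EG\to VG$. All graphs are locally finite: $|o^{-1}(v)|<\infty$ for every $v\in VG$. A path is either an empty path $\varepsilon_v$ ($v\in VG$) or a word $e_1\dots e_n$ ($n\ge 1$) of edges with $t(e_i)=o(e_{i+1})$. $\mathcal{W}(G)$ is the set of all paths; $O(e_1\dots e_n)=o(e_1)$, $T(e_1\dots e_n)=t(e_n)$, $O(\varepsilon_v)=T(\varepsilon_v)=v$; $\mathcal{W}(G,v)$ is the set of paths $p$ with $O(p)=v$. Paths $p,q$ with $T(p)=O(q)$ are concatenated to $pq$, empty paths being neutral. A rooted graph $(G,R)$ is a graph $G$ with a vertex $R$ (the root) from which every vertex can be reached by a directed path. Vanishing: for $R\ne v\in VG$ with no loops at $v$, the graph $G_v$ has $VG_v=VG\setminus\{v\}$ and $EG_v=\{e\in EG\mid o(e)\ne v,\ t(e)\neq v\}\cup\{(e_1,e_2)\in EG^2\mid t(e_1)=o(e_2)=v\}$; edges $e\in EG$ of $G_v$ keep their origin and terminus, and $o_{G_v}((e_1,e_2))=o(e_1)$, $t_{G_v}((e_1,e_2))=t(e_2)$.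 The unfolding tree $\mathcal{T}(G,R)$ has vertex set $\mathcal{W}(G,R)$ and edges $(p,pe)$ from $p$ to $pe$. The prefix order is $p\preceq q\iff q=pr$ for some path $r$. A set of paths is independent if none of its elements is a prefix of another one. A cofinite subspace of $\mathcal{T}(G,R)$ is a subset $\mathcal{S}\subseteq\mathcal{W}(G,R)$ with finite complement such that $p\in\mathcal{S}$, $p\preceq q$ imply $q\in\mathcal{S}$. Its basis is the unique finite independent subset $B\subseteq\mathcal{S}$ such that every $p\in\mathcal{S}$ has a prefix in $B$. An almost automorphism representative is an isomorphism $\phi:\mathcal{S}\to\mathcal{S}'$ between cofinite subspaces (a bijection preserving the prefix/forest structure in both directions). It is a Higman--Thompson representative if, for the basis $B$ of its domain, $\phi(bp)=\phi(b)p$ for all $b\in B$ and $p\in\mathcal{W}(G,T(b))$ (in particular $\phi(b)p$ is a path, so $T(\phi(b))=T(b)$). Two representatives are equivalent if they agree on some cofinite subspace. Equivalence classes of representatives form a group under composition of compatible (suitably restricted) representatives; $\mathcal{HT}(\mathcal{T}(G,R))$ is the subgroup of classes containing a Higman--Thompson representative. *)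

(* Defs.v *)
From HB Require Import structures.
From mathcomp Require Import all_boot.
From mathcomp Require Import boolp classical_sets functions cardinality.

Set Implicit Arguments.
Unset Strict Implicit.
Unset Printing Implicit Defensive.

Local Open Scope classical_set_scope.
Local Open Scope quotient_scope.

Record graph := Graph {
  vertex : Type;
  edge : Type;
  org : edge -> vertex;
  trm : edge -> vertex;
  locally_finite : forall v, finite_set (org @^-1` [set v]) }.

Section Paths.
Context {G : graph}.

Fixpoint is_path (v : vertex G) (p : seq (edge G)) : Prop :=
  if p is e :: p' then org e = v /\ is_path (trm e) p' else True.

(* [paths v] is W(G,v); the empty word stands for the empty path at v. *)
Definition paths (v : vertex G) := {p : seq (edge G) | is_path v p}.

Definition endpoint v (p : paths v) : vertex G := last v (map (@trm G) (sval p)).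

Lemma is_path_cat v (p q : seq (edge G)) :
  is_path v (p ++ q) <-> is_path v p /\ is_path (last v (map (@trm G) p)) q.
Proof.
elim: p v => [|e p IH] v /=; first by split=> // -[].
by split=> [[-> /IH[]]|[[-> pp] pq]]; do ?split=> //; apply/IH.
Qed.

Lemma pcat_subproof v (p : paths v) (r : paths (endpoint p)) :
  is_path v (sval p ++ sval r).
Proof. by apply/is_path_cat; split; [exact: (svalP p)|exact: (svalP r)]. Qed.

Definition pnil v : paths v := exist (is_path v) [::] I.

Definition pcat v (p : paths v) (r : paths (endpoint p)) : paths v :=
  exist (is_path v) (sval p ++ sval r) (pcat_subproof r).

Definition pprefix v (p q : paths v) : Prop :=
  exists r : paths (endpoint p), q = pcat r.

Definition rooted (R : vertex G) : Prop :=
  forall w, exists p : paths R, endpoint p = w.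

Lemma paths_inj v (p q : paths v) : sval p = sval q -> p = q.
Proof.
by case: p q => [p pP] [q qP] /= eq_pq; subst q; congr exist; exact: Prop_irrelevance.
Qed.

Lemma pprefixP v (p q : paths v) :
  pprefix p q <-> exists r, sval q = sval p ++ r.
Proof.
split=> [[r ->]|[r qE]]; first by exists (sval r).
have := svalP q; rewrite qE => /is_path_cat[_ rP].
by exists (exist (is_path (endpoint p)) r rP); exact: paths_inj.
Qed.

Lemma pprefix_refl v (p : paths v) : pprefix p p.
Proof. by apply/pprefixP; exists [::]; rewrite cats0. Qed.

Lemma pprefix_trans v (q p r : paths v) :
  pprefix p q -> pprefix q r -> pprefix p r.
Proof.
move=> /pprefixP[s qE] /pprefixP[u rE]; apply/pprefixP; exists (s ++ u).
by rewrite rE qE catA.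
Qed.

Lemma pprefix_anti v (p q : paths v) : pprefix p q -> pprefix q p -> p = q.
Proof.
move=> /pprefixP[s qE] /pprefixP[u pE]; apply: paths_inj.
move: (congr1 size pE); rewrite qE !size_cat -addnA -[LHS]addn0 => /addnI/esym.
by move=> /eqP; rewrite addn_eq0 => /andP[/nilP-> _]; rewrite cats0.
Qed.

Definition independent v (B : set (paths v)) : Prop :=
  forall b c, B b -> B c -> pprefix b c -> b = c.

Definition cofinite_subspace v (S : set (paths v)) : Prop :=
  finite_set (~` S) /\ forall p q, S p -> pprefix p q -> S q.

Definition is_basis v (S B : set (paths v)) : Prop :=
  [/\ finite_set B, independent B, B `<=` S &
      forall p, S p -> exists2 b, B b & pprefix b p].

Lemma cofinite_subspaceT v : cofinite_subspace [set: paths v].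
Proof. by split=> //; rewrite setCT. Qed.

Lemma cofinite_subspaceI v (S S' : set (paths v)) :
  cofinite_subspace S -> cofinite_subspace S' -> cofinite_subspace (S `&` S').
Proof.
move=> [fS uS] [fS' uS']; split; first by rewrite setCI finite_setU.
by move=> p q [Sp S'p] pq; split; [exact: uS pq|exact: uS' pq].
Qed.

Lemma basis_exists v (S : set (paths v)) :
  cofinite_subspace S -> exists B, is_basis S B.
Proof.
move=> [fS uS].
pose B := [set b | S b /\ forall c, S c -> pprefix c b -> c = b].
have pre (p : paths v) n : is_path v (take n (sval p)).
  by have := svalP p; rewrite -{1}(cat_take_drop n (sval p)) => /is_path_cat[].
exists B; split; last 2 first.
- by move=> b [].
- move=> p; have [n] := ubnP (size (sval p)).
  elim: n p => // n IH p szp Sp.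
  have [pB|npB] := pselect (B p); first by exists p => //; exact: pprefix_refl.
  have [c Sc [cp ncp]] : exists2 c, S c & pprefix c p /\ c <> p.
    apply: contrapT => Hn; apply: npB; split=> // c Sc cp.
    by apply: contrapT => ncp; apply: Hn; exists c.
  have szc : size (sval c) < n.
    have [r pE] := (pprefixP c p).1 cp.
    case: r pE => [|e r] pE.
      by case: ncp; apply: paths_inj; rewrite pE cats0.
    by move: szp; rewrite pE size_cat /= addnS ltnS; apply/leq_ltn_trans/leq_addr.
  have [b Bb bc] := IH c szc Sc.
  by exists b => //; exact: pprefix_trans cp.
- have sub : B `<=` [set pnil v] `|`
      \bigcup_(q in ~` S) [set p | exists2 e, org e = endpoint q & sval p = rcons (sval q) e].
    move=> b [Sb bmin].
    have [bE|[q [e bE]]] : sval b = [::] \/ exists q e, sval b = rcons q e.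
      by case/lastP: (sval b) => [|q e]; [left|right; exists q, e].
      by left; apply: paths_inj.
    right.
    have bP := svalP b; rewrite bE -cats1 in bP.
    have [qP [oe _]] := (is_path_cat v q [:: e]).1 bP.
    exists (exist _ q qP); last by exists e.
    move=> Sq; have bE' : exist _ q qP = b.
      by apply: (bmin _ Sq); apply/pprefixP; exists [:: e]; rewrite cats1.
    have := congr1 size bE; rewrite -bE' /= size_rcons => /eqP.
    by rewrite eqn_leq ltnn andbF.
  apply: sub_finite_set sub _; rewrite finite_setU; split; first exact: finite_set1.
  apply: bigcup_finite => [|q _]; first exact: fS.
  apply: (@sub_finite_set _ _ ((fun e => if pselect (is_path v (rcons (sval q) e)) is left h
     then exist (is_path v) _ h else pnil v) @` (@org G @^-1` [set endpoint q]))).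
    move=> p [e oe pE]; exists e => //.
    case: pselect => [h|[]]; first by apply: paths_inj.
    by rewrite -pE; exact: svalP.
  by apply: finite_image; exact: locally_finite.
by move=> b c [Sb _] [_ cmin] bc; exact: cmin.
Qed.

Lemma basis_unique v (S B C : set (paths v)) :
  is_basis S B -> is_basis S C -> B = C.
Proof.
have sub (B' C' : set (paths v)) : is_basis S B' -> is_basis S C' -> B' `<=` C'.
  move=> [_ iB BS gB] [_ _ CS gC] b Bb.
  have [c Cc cb] := gC _ (BS _ Bb); have [b' Bb' b'c] := gB _ (CS _ Cc).
  have eb := iB _ _ Bb' Bb (pprefix_trans b'c cb); subst b'.
  by rewrite (pprefix_anti b'c cb).
by move=> hB hC; apply/seteqP; split; exact: sub.
Qed.

End Paths.

Section AlmostAutomorphisms.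
Context {G : graph} {R : vertex G}.

(* [aa_fun] is a total function whose values outside [dom] are irrelevant. The
   edges of the forest induced on a cofinite subspace are the covering pairs of
   the prefix order, so forest isomorphisms are the order isomorphisms. *)
Record aa_rep := AARep {
  dom : set (paths R);
  cod : set (paths R);
  aa_fun :> paths R -> paths R;
  dom_cofinite : cofinite_subspace dom;
  cod_cofinite : cofinite_subspace cod;
  aa_bij : set_bij dom cod aa_fun;
  aa_prefix : forall p q, dom p -> dom q ->
    (pprefix p q <-> pprefix (aa_fun p) (aa_fun q)) }.

HB.instance Definition _ := gen_eqMixin aa_rep.
HB.instance Definition _ := gen_choiceMixin aa_rep.

Definition is_HT (phi : aa_rep) : Prop :=
  exists2 B, is_basis (dom phi) B &
    forall b, B b -> endpoint (phi b) = endpoint b /\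
      forall p : paths (endpoint b), sval (phi (pcat p)) = sval (phi b) ++ sval p.

Definition aa_agree (phi psi : aa_rep) : Prop :=
  exists S, [/\ cofinite_subspace S, S `<=` dom phi, S `<=` dom psi &
                {in S, phi =1 psi}].

Lemma aa_funP phi p : dom phi p -> cod phi (phi p).
Proof. by case: (aa_bij phi) => f _ _; exact: f. Qed.

Lemma aa_fun_inj (phi : aa_rep) p q :
  dom phi p -> dom phi q -> phi p = phi q -> p = q.
Proof. by case: (aa_bij phi) => _ i _ pd qd; apply: i; rewrite inE. Qed.

Lemma aa_fun_surj (phi : aa_rep) q : cod phi q -> exists2 p, dom phi p & phi p = q.
Proof. by case: (aa_bij phi) => _ _ s /s. Qed.

Lemma dom_up (phi : aa_rep) p q : dom phi p -> pprefix p q -> dom phi q.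
Proof. exact: (dom_cofinite phi).2. Qed.

Lemma cod_up (phi : aa_rep) p q : cod phi p -> pprefix p q -> cod phi q.
Proof. exact: (cod_cofinite phi).2. Qed.

Definition aa_inv_fun (phi : aa_rep) (q : paths R) : paths R :=
  if pselect (exists2 p, dom phi p & phi p = q) is left h
  then sval (cid2 h) else q.

Lemma aa_inv_funP (phi : aa_rep) q :
  cod phi q -> dom phi (aa_inv_fun phi q) /\ phi (aa_inv_fun phi q) = q.
Proof.
rewrite /aa_inv_fun => /aa_fun_surj h; case: pselect => // h'.
by case: (cid2 h').
Qed.

Lemma aa_inv_funK (phi : aa_rep) p : dom phi p -> aa_inv_fun phi (phi p) = p.
Proof.
move=> dp; have [d e] := aa_inv_funP (aa_funP dp).
exact: aa_fun_inj e.
Qed.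

Lemma aa_image_cofinite (phi : aa_rep) S :
  cofinite_subspace S -> S `<=` dom phi -> cofinite_subspace (phi @` S).
Proof.
move=> [fS uS] Sd; split.
  apply: (@sub_finite_set _ _ (~` cod phi `|` phi @` (~` S))); last first.
    by rewrite finite_setU; split; [exact: (cod_cofinite phi).1|exact: finite_image].
  move=> q nq; have [/aa_fun_surj[p dp pq]|] := pselect (cod phi q); last by left.
  by right; exists p => //; apply: contra_not nq => Sp; exists p.
move=> _ q [p Sp <-] pq.
have [p' dp' p'q] := aa_fun_surj (cod_up (aa_funP (Sd _ Sp)) pq).
exists p' => //; apply: (uS _ _ Sp); apply/(aa_prefix (Sd _ Sp) dp').
by rewrite p'q.
Qed.

Lemma aa_id_bij : set_bij [set: paths R] setT id.
Proof. by split=> // q _; exists q. Qed.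

Definition aa_id : aa_rep :=
  AARep (cofinite_subspaceT R) (cofinite_subspaceT R) aa_id_bij
    (fun _ _ _ _ => iff_refl _).

Lemma aa_inv_bij (phi : aa_rep) : set_bij (cod phi) (dom phi) (aa_inv_fun phi).
Proof.
split.
- by move=> q /aa_inv_funP[].
- move=> p q; rewrite !inE => /aa_inv_funP[_ pE] /aa_inv_funP[_ qE] e.
  by rewrite -pE -qE e.
- by move=> p dp; exists (phi p); [exact: aa_funP|exact: aa_inv_funK].
Qed.

Lemma aa_inv_prefix (phi : aa_rep) p q : cod phi p -> cod phi q ->
  (pprefix p q <-> pprefix (aa_inv_fun phi p) (aa_inv_fun phi q)).
Proof.
move=> cp cq.
have [dp pE] := aa_inv_funP cp; have [dq qE] := aa_inv_funP cq.
by rewrite -{1}pE -{1}qE; apply: iff_sym; exact: aa_prefix.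
Qed.

Definition aa_inv (phi : aa_rep) : aa_rep :=
  AARep (cod_cofinite phi) (dom_cofinite phi) (aa_inv_bij phi)
    (@aa_inv_prefix phi).

Lemma aa_comp_dom_cofinite (phi psi : aa_rep) :
  cofinite_subspace (dom psi `&` psi @^-1` dom phi).
Proof.
have -> : dom psi `&` psi @^-1` dom phi = aa_inv psi @` (cod psi `&` dom phi).
  apply/seteqP; split=> [p [dp dpp]|_ [q [cq dq] <-]] /=.
    by exists (psi p); [split=> //; exact: aa_funP|exact: aa_inv_funK].
  by have [? qE] := aa_inv_funP cq; split=> //=; rewrite qE.
apply: aa_image_cofinite; last by move=> q [].
by apply: cofinite_subspaceI; [exact: cod_cofinite|exact: dom_cofinite].
Qed.

Lemma aa_comp_cod_cofinite (phi psi : aa_rep) :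
  cofinite_subspace (phi @` (cod psi `&` dom phi)).
Proof.
apply: aa_image_cofinite; last by move=> q [].
by apply: cofinite_subspaceI; [exact: cod_cofinite|exact: dom_cofinite].
Qed.

Lemma aa_comp_bij (phi psi : aa_rep) :
  set_bij (dom psi `&` psi @^-1` dom phi) (phi @` (cod psi `&` dom phi))
    (phi \o psi).
Proof.
split.
- by move=> p [dp dpp]; exists (psi p) => //; split=> //; exact: aa_funP.
- move=> p q; rewrite !inE => -[dp dpp] [dq dqq] /= /(aa_fun_inj dpp dqq).
  exact: aa_fun_inj.
- by move=> _ [q [/aa_fun_surj[p dp <-] dq] <-]; exists p.
Qed.

Lemma aa_comp_prefix (phi psi : aa_rep) p q :
  (dom psi `&` psi @^-1` dom phi) p -> (dom psi `&` psi @^-1` dom phi) q ->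
  (pprefix p q <-> pprefix ((phi \o psi) p) ((phi \o psi) q)).
Proof.
move=> [dp dpp] [dq dqq].
by apply: (iff_trans (aa_prefix dp dq)); exact: aa_prefix.
Qed.

Definition aa_comp (phi psi : aa_rep) : aa_rep :=
  AARep (aa_comp_dom_cofinite phi psi) (aa_comp_cod_cofinite phi psi)
    (aa_comp_bij phi psi) (@aa_comp_prefix phi psi).

Lemma aa_agree_refl phi : aa_agree phi phi.
Proof. by exists (dom phi); split=> //; exact: dom_cofinite. Qed.

Lemma aa_agree_sym phi psi : aa_agree phi psi -> aa_agree psi phi.
Proof. by move=> [S [fS ? ? e]]; exists S; split=> // p /e. Qed.

Lemma aa_agree_trans psi phi chi :
  aa_agree phi psi -> aa_agree psi chi -> aa_agree phi chi.
Proof.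
move=> [S [fS S1 S2 e]] [S' [fS' S1' S2' e']]; exists (S `&` S').
split; first exact: cofinite_subspaceI.
- by move=> p [/S1].
- by move=> p [_ /S2'].
- by move=> p; rewrite inE => -[Sp S'p]; rewrite e ?e' ?inE.
Qed.

Definition aa_equiv (phi psi : aa_rep) : bool := `[< aa_agree phi psi >].

Lemma aa_equiv_refl : reflexive aa_equiv.
Proof. by move=> phi; apply/asboolP; exact: aa_agree_refl. Qed.

Lemma aa_equiv_sym : symmetric aa_equiv.
Proof. by move=> phi psi; apply/asboolP/asboolP; exact: aa_agree_sym. Qed.

Lemma aa_equiv_trans : transitive aa_equiv.
Proof.
by move=> psi phi chi /asboolP h /asboolP k; apply/asboolP/(aa_agree_trans h k).
Qed.

Canonical aa_equiv_equivRel :=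
  EquivRel aa_equiv aa_equiv_refl aa_equiv_sym aa_equiv_trans.

Lemma aa_comp_agree phi phi' psi psi' :
  aa_agree phi phi' -> aa_agree psi psi' ->
  aa_agree (aa_comp phi psi) (aa_comp phi' psi').
Proof.
move=> [S [fS Sd Sd' e]] [U [fU Ud Ud' e']].
pose X := aa_inv psi @` (S `&` psi @` U).
have XP p : X p -> [/\ U p & S (psi p)].
  move=> [q [Sq [u Uu uq]] <-]; subst q; rewrite /=.
  by rewrite aa_inv_funK //; exact: Ud.
exists X; split.
- apply: aa_image_cofinite.
    by apply: cofinite_subspaceI => //; exact: aa_image_cofinite.
  by move=> _ [_ [u Uu <-]]; apply: aa_funP; exact: Ud.
- by move=> p /XP[Up Sp]; split; [exact: Ud|exact: Sd].
- by move=> p /XP[Up Sp]; split; [exact: Ud'|rewrite /= -e' ?inE//; exact: Sd'].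
- by move=> p; rewrite inE => /XP[Up Sp] /=; rewrite -e' ?inE// e ?inE.
Qed.

Lemma aa_inv_agree phi psi :
  aa_agree phi psi -> aa_agree (aa_inv phi) (aa_inv psi).
Proof.
move=> [S [fS Sd Sd' e]]; exists (phi @` S); split.
- exact: aa_image_cofinite.
- by move=> _ [p Sp <-]; apply: aa_funP; exact: Sd.
- by move=> _ [p Sp <-]; rewrite e ?inE//; apply: aa_funP; exact: Sd'.
- move=> q; rewrite inE => -[p Sp <-] /=.
  by rewrite (aa_inv_funK (Sd _ Sp)) e ?inE// (aa_inv_funK (Sd' _ Sp)).
Qed.

Lemma aa_eq_agree (phi psi : aa_rep) :
  dom phi `<=` dom psi -> {in dom phi, phi =1 psi} -> aa_agree phi psi.
Proof. by move=> s e; exists (dom phi); split=> //; exact: dom_cofinite. Qed.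

Lemma aa_HT_restrict (phi : aa_rep) (B : set (paths R)) b q :
  (forall b, B b -> endpoint (phi b) = endpoint b /\
      forall p : paths (endpoint b), sval (phi (pcat p)) = sval (phi b) ++ sval p) ->
  B b -> pprefix b q ->
  endpoint (phi q) = endpoint q /\
    forall p : paths (endpoint q), sval (phi (pcat p)) = sval (phi q) ++ sval p.
Proof.
move=> HB Bb [r ->{q}]; have [eb hb] := HB _ Bb; split.
  rewrite /endpoint hb /= !map_cat !last_cat; congr last; exact: eb.
move=> p; have rpP : is_path (endpoint b) (sval r ++ sval p).
  have := svalP (pcat p); rewrite /= -catA => /is_path_cat[_ //].
have -> : pcat p = pcat (exist (is_path (endpoint b)) _ rpP).
  by apply: paths_inj; rewrite /= catA.
by rewrite !hb /= catA.
Qed.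

Lemma is_HT_id : is_HT aa_id.
Proof.
exists [set pnil R]; last by [].
split=> //.
- by move=> _ _ -> ->.
- by move=> p _; exists (pnil R) => //; apply/pprefixP; exists (sval p).
Qed.

Lemma is_HT_inv phi : is_HT phi -> is_HT (aa_inv phi).
Proof.
move=> [B [fB iB BS gB] HB]; exists (phi @` B); first split.
- exact: finite_image.
- move=> _ _ [b Bb <-] [c Bc <-] /(aa_prefix (BS _ Bb) (BS _ Bc)) h.
  by congr (phi _); exact: iB.
- by move=> _ [b Bb <-]; apply: aa_funP; exact: BS.
- move=> q cq; have [d qE] := aa_inv_funP cq.
  have [b Bb bq] := gB _ d; exists (phi b); first by exists b.
  by rewrite -qE; apply/(aa_prefix (BS _ Bb) d).
move=> _ [b Bb <-] /=; have [eb hb] := HB _ Bb; have db := BS _ Bb.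
rewrite aa_inv_funK //; split=> // p.
have pP : is_path (endpoint b) (sval p) by rewrite -eb; exact: svalP.
pose p' : paths (endpoint b) := exist _ (sval p) pP.
have -> : pcat p = phi (pcat p') by apply: paths_inj; rewrite hb.
by rewrite aa_inv_funK //; apply: (dom_up db); exists p'.
Qed.

Lemma is_HT_comp phi psi : is_HT phi -> is_HT psi -> is_HT (aa_comp phi psi).
Proof.
move=> [B [_ _ _ gB] HB] [C [_ _ _ gC] HC].
have [D [fD iD DS gD]] := basis_exists (dom_cofinite (aa_comp phi psi)).
exists D => // d Dd; have [dd dpd] := DS _ Dd.
have [c Cc cd] := gC _ dd; have [b Bb bd] := gB _ dpd.
have [e1 h1] := aa_HT_restrict HC Cc cd.
have [e2 h2] := aa_HT_restrict HB Bb bd.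
split; first by rewrite /= e2 e1.
move=> p /=.
have pP : is_path (endpoint (psi d)) (sval p) by rewrite e1; exact: svalP.
pose p' : paths (endpoint (psi d)) := exist _ (sval p) pP.
have -> : psi (pcat p) = pcat p' by apply: paths_inj; rewrite h1.
by rewrite h2.
Qed.

End AlmostAutomorphisms.

Arguments aa_rep {G} R.

Definition AAut (G : graph) (R : vertex G) := {eq_quot @aa_equiv G R}.

Section AAutGroup.
Context (G : graph) (R : vertex G).
Local Notation AAut := (AAut R).

HB.instance Definition _ := Choice.on AAut.
HB.instance Definition _ := EqQuotient.on AAut.

Lemma aa_piE (phi psi : aa_rep R) :
  \pi_AAut phi = \pi_AAut psi <-> aa_agree phi psi.
Proof. by split=> [/eqmodP/asboolP|h] //; apply/eqmodP/asboolP. Qed.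

Lemma aa_reprP (phi : aa_rep R) : aa_agree (repr (\pi_AAut phi)) phi.
Proof. by apply/aa_piE; rewrite reprK. Qed.

Definition AAut_one : AAut := \pi_AAut aa_id.
Definition AAut_mul (x y : AAut) : AAut := \pi_AAut (aa_comp (repr x) (repr y)).
Definition AAut_inv (x : AAut) : AAut := \pi_AAut (aa_inv (repr x)).

Lemma AAut_mulE (phi psi : aa_rep R) :
  AAut_mul (\pi_AAut phi) (\pi_AAut psi) = \pi_AAut (aa_comp phi psi).
Proof. by apply/aa_piE/aa_comp_agree; exact: aa_reprP. Qed.

Lemma AAut_invE (phi : aa_rep R) : AAut_inv (\pi_AAut phi) = \pi_AAut (aa_inv phi).
Proof. by apply/aa_piE/aa_inv_agree; exact: aa_reprP. Qed.

Lemma AAut_mulA : associative AAut_mul.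
Proof.
elim/quotW=> x; elim/quotW=> y; elim/quotW=> z.
rewrite (AAut_mulE y) (AAut_mulE x y) !AAut_mulE.
by apply/aa_piE/aa_eq_agree => // p [[dp h] k].
Qed.

Lemma AAut_mul1 : left_id AAut_one AAut_mul.
Proof.
by elim/quotW=> x; rewrite AAut_mulE; apply/aa_piE/aa_eq_agree => // p [].
Qed.

Lemma AAut_mulr1 : right_id AAut_one AAut_mul.
Proof.
by elim/quotW=> x; rewrite AAut_mulE; apply/aa_piE/aa_eq_agree => // p [].
Qed.

Lemma AAut_mulV : left_inverse AAut_one AAut_inv AAut_mul.
Proof.
elim/quotW=> x; rewrite AAut_invE AAut_mulE; apply/aa_piE/aa_eq_agree => // p.
by rewrite inE => -[dp _]; exact: aa_inv_funK.
Qed.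

Lemma AAut_mulrV : right_inverse AAut_one AAut_inv AAut_mul.
Proof.
elim/quotW=> x; rewrite AAut_invE AAut_mulE; apply/aa_piE/aa_eq_agree => // p.
by rewrite inE => -[cp _]; exact: (aa_inv_funP cp).2.
Qed.

HB.instance Definition _ := isGroup.Build AAut
  AAut_mulA AAut_mul1 AAut_mulr1 AAut_mulV AAut_mulrV.

Definition in_HT : pred AAut :=
  fun x => `[< exists2 phi : aa_rep R, is_HT phi & x = \pi_AAut phi >].

Lemma in_HT_group : group_closed in_HT.
Proof.
split; first by apply/asboolP; exists aa_id => //; exact: is_HT_id.
move=> _ _ /asboolP[phi hphi ->] /asboolP[psi hpsi ->]; apply/asboolP.
exists (aa_comp phi (aa_inv psi)).
  by apply: is_HT_comp => //; exact: is_HT_inv.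
by rewrite -AAut_mulE -AAut_invE.
Qed.

End AAutGroup.

Record HT (G : graph) (R : vertex G) := HTElem {
  HT_val : AAut R;
  HT_valP : in_HT HT_val }.
Arguments HT : clear implicits.

HB.instance Definition _ (G : graph) (R : vertex G) :=
  [isSub for @HT_val G R].
HB.instance Definition _ (G : graph) (R : vertex G) :=
  [Choice of HT G R by <:].
HB.instance Definition _ (G : graph) (R : vertex G) :=
  SubChoice_isSubGroup.Build (AAut R) (@in_HT G R) (HT G R) (@in_HT_group G R).

Section Vanish.
Context {G : graph} {v : vertex G}.

Definition loopless (v : vertex G) : Prop :=
  @org G @^-1` [set v] `&` @trm G @^-1` [set v] = set0.

Context (nl : loopless v).

Lemma loopless_org (e : edge G) : trm e = v -> org e <> v.
Proof. by move=> te oe; have : (set0 : set (edge G)) e by rewrite -nl. Qed.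

Lemma loopless_trm (e : edge G) : org e = v -> trm e <> v.
Proof. by move=> oe /loopless_org. Qed.

Definition vanish_vertex := {w : vertex G | w <> v}.

Definition vanish_edge : Type :=
  {e : edge G | org e <> v /\ trm e <> v} +
  {e : edge G * edge G | trm e.1 = v /\ org e.2 = v}.

Definition vanish_org (e : vanish_edge) : vanish_vertex :=
  match e with
  | inl e => exist _ (org (sval e)) (svalP e).1
  | inr e => exist _ (org (sval e).1) (loopless_org (svalP e).1)
  end.

Definition vanish_trm (e : vanish_edge) : vanish_vertex :=
  match e with
  | inl e => exist _ (trm (sval e)) (svalP e).2
  | inr e => exist _ (trm (sval e).2) (loopless_trm (svalP e).2)
  end.

Lemma vanish_locally_finite (w : vanish_vertex) :
  finite_set (vanish_org @^-1` [set w]).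
Proof.
pose f (e : vanish_edge) : edge G + edge G * edge G :=
  match e with inl e => inl (sval e) | inr e => inr (sval e) end.
have f_inj : injective f.
  by move=> [[x xP]|[x xP]] [[y yP]|[y yP]] //= [] e; subst y;
    rewrite (Prop_irrelevance xP yP).
set D := inl @` (@org G @^-1` [set sval w]) `|`
  inr @` ((@org G @^-1` [set sval w]) `*` (@org G @^-1` [set v])).
apply: (@sub_finite_set _ _ (f @^-1` D)).
  move=> [[e eP]|[[e1 e2] [t1 o2]]] /= we; [left; exists e|right; exists (e1, e2)] => //.
    by rewrite /= -we.
  by split=> //=; rewrite -we.
apply: finite_preimage; first by move=> x y _ _; exact: f_inj.
rewrite finite_setU; split; apply: finite_image; first exact: locally_finite.
by apply: finite_setX; exact: locally_finite.
Qed.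

Definition vanish : graph :=
  @Graph vanish_vertex vanish_edge vanish_org vanish_trm vanish_locally_finite.

Definition vanish_root (R : vertex G) (vR : R <> v) : vertex vanish :=
  exist _ R vR.

End Vanish.

(* Main.v *)
Require Import Defs.
From HB Require Import structures.
From mathcomp Require Import all_boot.
From mathcomp Require Import boolp classical_sets functions cardinality.

(** Expanding each composite edge [(e1, e2)] of the vanished graph into [e1 e2]
    embeds its paths from [R] as the paths of [G] from [R] that do not end at [v];
    every path of [G] from [R] is uniquely an embedded path followed by a stub,
    which is empty or a single edge into [v]. A Higman--Thompson representative
    preserves endpoints and commutes with appending a tail anywhere on its domain,
    so it restricts to embedded paths, and the restriction determines it up to
    finitely many paths. Conversely, a representative over the vanished graph
    extends to [G] by leaving stubs unchanged. *)

Set Implicit Arguments.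
Unset Strict Implicit.
Unset Printing Implicit Defensive.

Local Open Scope classical_set_scope.
Local Open Scope quotient_scope.

(** * Higman--Thompson representatives without bases *)

Section TailPreserving.
Context {G : graph} {R : vertex G}.

(* [is_HT] with the whole domain in place of its basis, and with concatenation
   of words instead of the dependently typed [pcat]. *)
Definition tail_preserving (D : set (paths R)) (f : paths R -> paths R) : Prop :=
  forall p, D p -> endpoint (f p) = endpoint p /\
    forall q r, sval q = sval p ++ r -> sval (f q) = sval (f p) ++ r.

Lemma is_HT_tail (phi : aa_rep R) : is_HT phi -> tail_preserving (dom phi) phi.
Proof.
move=> [B [_ _ _ gB] HB] p dp; have [b Bb bp] := gB _ dp.
have [ep hp] := aa_HT_restrict HB Bb bp; split=> // q r qE.
have [s qs] : pprefix p q by apply/pprefixP; exists r.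
rewrite qs hp; congr (_ ++ _).
by have := congr1 (drop (size (sval p))) qE; rewrite qs /= !drop_size_cat.
Qed.

Lemma tail_is_HT (phi : aa_rep R) : tail_preserving (dom phi) phi -> is_HT phi.
Proof.
move=> h; have [B BP] := basis_exists (dom_cofinite phi).
exists B => // b Bb; case: BP => _ _ BS _; have [eb hb] := h _ (BS _ Bb).
by split=> // p; exact: hb.
Qed.

(** If [f p] is a prefix of [f q], equality of endpoints lets the remaining tail follow [p] as well;
    the resulting path has the same image as [q], so injectivity makes it [q]. *)
Lemma tail_prefix (D D' : set (paths R)) f :
  cofinite_subspace D -> set_bij D D' f -> tail_preserving D f ->
  forall p q, D p -> D q -> (pprefix p q <-> pprefix (f p) (f q)).
Proof.
move=> [_ uD] [_ injf _] h p q Dp Dq; have [ep hp] := h _ Dp; split.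
  by move=> /pprefixP[r qE]; apply/pprefixP; exists r; exact: hp.
move=> [r fqE]; have rP : is_path (endpoint p) (sval r).
  by rewrite -ep; exact: svalP.
pose s : paths (endpoint p) := exist _ (sval r) rP.
exists s; apply: injf; rewrite ?inE//; first by apply: uD Dp _; exists s.
by apply: paths_inj; rewrite fqE /= (hp (pcat s) (sval r)).
Qed.

Lemma HT_val_inj : injective (@HT_val G R).
Proof. exact: val_inj. Qed.

Lemma HT_rep_exists (x : HT G R) :
  exists2 phi : aa_rep R, is_HT phi & HT_val x = \pi_(AAut R) phi.
Proof. by case: x => x /= /asboolP. Qed.

(** [repr] need not return a Higman--Thompson representative, so one is chosen separately. *)
Definition HT_rep (x : HT G R) : aa_rep R := sval (cid2 (HT_rep_exists x)).

Lemma HT_rep_HT x : is_HT (HT_rep x).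
Proof. by rewrite /HT_rep; case: cid2. Qed.

Lemma HT_repK x : \pi_(AAut R) (HT_rep x) = HT_val x.
Proof. by rewrite /HT_rep; case: cid2. Qed.

Definition HT_pi (phi : aa_rep R) (h : is_HT phi) : HT G R :=
  @HTElem G R (\pi_(AAut R) phi)
    (asboolT (ex_intro2 _ (fun psi => \pi_(AAut R) phi = \pi_(AAut R) psi) phi h erefl)).

Lemma HT_rep_pi phi (h : is_HT phi) : aa_agree (HT_rep (HT_pi h)) phi.
Proof. by apply/aa_piE; rewrite HT_repK. Qed.

Lemma HT_rep_mul x y : aa_agree (HT_rep (x * y)%g) (aa_comp (HT_rep x) (HT_rep y)).
Proof. by apply/aa_piE; rewrite -AAut_mulE !HT_repK. Qed.

End TailPreserving.

(** * Expanding words over the vanished graph *)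

Section Vanishing.
Context {G : graph} {v : vertex G} (nl : loopless v).
Local Notation Gv := (vanish nl).

Definition expand_edge (e : edge Gv) : seq (edge G) :=
  match e with
  | inl e => [:: sval e]
  | inr e => [:: (sval e).1; (sval e).2]
  end.

Definition expand (s : seq (edge Gv)) : seq (edge G) := flatten (map expand_edge s).

Lemma expand_cat s t : expand (s ++ t) = expand s ++ expand t.
Proof. by rewrite /expand map_cat flatten_cat. Qed.

Lemma expand_path (w : vertex Gv) s : is_path w s ->
  is_path (sval w) (expand s) /\
  last (sval w) (map (@trm G) (expand s)) = sval (last w (map (@trm Gv) s)).
Proof.
elim: s w => [|[[e [eo et]]|[[e1 e2] [/= t1 o2]]] s IH] w //= [<-] /IH[sP ->] //.
by do 3?split=> //; rewrite o2.
Qed.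

Lemma path_expand (w : vertex Gv) s : is_path (sval w) (expand s) -> is_path w s.
Proof.
have vv (a b : vertex Gv) : sval a = sval b -> a = b.
  by case: a b => [a aP] [b bP] /= ab; subst b; rewrite (Prop_irrelevance aP bP).
elim: s w => [|[[e [eo et]]|[[e1 e2] [/= t1 o2]]] s IH] w //=.
  by move=> [oe sP]; split; [exact: vv|exact: IH].
by move=> [oe [_ sP]]; split; [exact: vv|exact: IH].
Qed.

Definition stub (t : seq (edge G)) : Prop :=
  t = [::] \/ exists2 e, trm e = v & t = [:: e].

(** An edge into [v] is either the last letter or forms a composite edge with its successor, which
    leaves [v] and, as there are no loops, ends away from [v], so the induction continues. *)
Lemma expand_stub_exists (w : vertex G) p : w <> v -> is_path w p ->
  exists s t, stub t /\ p = expand s ++ t.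
Proof.
have [n] := ubnP (size p); elim: n w p => // n IH w [|e p] /= szp wv.
  by exists [::], [::]; split=> //; left.
move=> [oe pP]; have [te|te] := pselect (trm e = v); last first.
  have [s [t [tP ->]]] := IH _ p szp te pP.
  have eP : org e <> v /\ trm e <> v by rewrite oe.
  by exists ((inl (exist _ e eP) : edge Gv) :: s), t.
case: p szp pP => [|f p] szp /=.
  by exists [::], [:: e]; split=> //; right; exists e.
move=> [of_ pP].
have fP : trm (e, f).1 = v /\ org (e, f).2 = v by rewrite /= of_.
have [s [t [tP ->]]] := IH _ p (ltnW szp) (loopless_trm nl fP.2) pP.
by exists ((inr (exist _ (e, f) fP) : edge Gv) :: s), t.
Qed.

(* The words [expand_edge e] form a prefix code, and no stub starts with a code word. *)
Lemma expand_prefix s s' u t : stub t -> expand s ++ u = expand s' ++ t ->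
  exists2 r, s' = s ++ r & u = expand r ++ t.
Proof.
move=> tP; elim: s s' => [|e s IH] s' /=; first by exists s'.
case: s' => [|e' s'] /=.
  move: e => [[e [eo et]]|[[e1 e2] [/= t1 o2]]] /=;
    by case: tP => [->|[f tf ->]] //= [ef]; rewrite -ef in tf.
have step a b : a = b -> expand s ++ u = expand s' ++ t ->
    exists2 r, b :: s' = a :: (s ++ r) & u = expand r ++ t.
  by move=> -> /IH[r -> ->]; exists r.
(* A one-letter code word ends away from [v], while the first letter of a two-letter one ends at
   [v]; this excludes the mixed cases. *)
case: e => [[e [eo et]]|[[e1 e2] [/= t1 o2]]];
  case: e' => [[f [fo ft]]|[[f1 f2] [/= t1' o2']]] /=.
- by move=> [ef]; subst f; apply: step; congr inl; congr exist; exact: Prop_irrelevance.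
- by move=> [ef]; subst f1.
- by move=> [ef]; subst f.
- move=> [ef1 ef2]; subst f1 f2; apply: step; congr inr; congr exist.
  exact: Prop_irrelevance.
Qed.

(** [expand_prefix] makes each of [s], [s'] a prefix of the other; comparing lengths leaves an empty
    remainder. *)
Lemma expand_inj s s' t t' : stub t -> stub t' ->
  expand s ++ t = expand s' ++ t' -> s = s' /\ t = t'.
Proof.
move=> tP tP' E; have [r s'E tE] := expand_prefix tP' E.
have [r' sE _] := expand_prefix tP (esym E).
suff r0 : r = [::] by rewrite s'E tE r0 cats0.
apply: size0nil; apply/eqP; move: (congr1 size sE).
rewrite s'E !size_cat -addnA -[LHS]addn0 => /addnI/esym/eqP.
by rewrite addn_eq0 => /andP[].
Qed.

(** * Splitting a path into embedded core and stub *)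

Context {R : vertex G} (vR : R <> v).
Local Notation Rv := (vanish_root nl vR).

Definition embed (q : paths Rv) : paths R :=
  exist _ (expand (sval q)) (expand_path (svalP q)).1.

Lemma embed_endpoint q : endpoint (embed q) = sval (endpoint q).
Proof. exact: (expand_path (svalP q)).2. Qed.

Lemma embed_prefix p q : pprefix p q -> pprefix (embed p) (embed q).
Proof.
by move=> /pprefixP[r qE]; apply/pprefixP; exists (expand r); rewrite /= qE expand_cat.
Qed.

Lemma core_exists (p : paths R) :
  exists qt : paths Rv * seq (edge G),
    stub qt.2 /\ sval p = expand (sval qt.1) ++ qt.2.
Proof.
have [s [t [tP pE]]] := expand_stub_exists vR (svalP p).
have := svalP p; rewrite pE => /is_path_cat[/(@path_expand Rv) sP _].
by exists (exist _ s sP, t).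
Qed.

Definition core (p : paths R) : paths Rv := (sval (cid (core_exists p))).1.
Definition rest (p : paths R) : seq (edge G) := (sval (cid (core_exists p))).2.

Lemma rest_stub p : stub (rest p).
Proof. by rewrite /rest; case: cid => -[q t] []. Qed.

Lemma core_rest p : sval p = expand (sval (core p)) ++ rest p.
Proof. by rewrite /core /rest; case: cid => -[q t] []. Qed.

Lemma core_unique p q t : stub t -> sval p = expand (sval q) ++ t ->
  core p = q /\ rest p = t.
Proof.
move=> tP; rewrite core_rest => /(expand_inj (rest_stub p) tP)[cE rE].
by split=> //; exact: paths_inj.
Qed.

Lemma embedK : cancel embed core.
Proof.
by move=> q; have [] // := @core_unique (embed q) q [::] (or_introl erefl);
   rewrite cats0.
Qed.

Lemma rest_embed q : rest (embed q) = [::].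
Proof.
by have [] // := @core_unique (embed q) q [::] (or_introl erefl); rewrite cats0.
Qed.

Lemma coreK p : endpoint p <> v -> embed (core p) = p.
Proof.
move=> pv; apply: paths_inj; rewrite [RHS]core_rest /=.
case: (rest_stub p) => [->|[e te rE]]; first by rewrite cats0.
case: pv; rewrite /endpoint core_rest rE map_cat last_cat /=; exact: te.
Qed.

(** If [p] ends at [v], the first edge of [r] merges with the stub of [p] into a composite edge;
    hence [rest p ++ r], not [r], is what factors. *)
Lemma core_cat p p' r : sval p' = sval p ++ r ->
  exists2 s, sval (core p') = sval (core p) ++ s & rest p ++ r = expand s ++ rest p'.
Proof. by rewrite !core_rest -catA => /esym/(expand_prefix (rest_stub p')). Qed.

Lemma core_prefix p q : pprefix p q -> pprefix (core p) (core q).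
Proof. by move=> /pprefixP[r /core_cat[s qE _]]; apply/pprefixP; exists s. Qed.

(** Local finiteness enters: besides [embed q], the fibre contains only extensions of it by one edge
    leaving its endpoint. *)
Lemma core_fiber_finite q : finite_set [set p | core p = q].
Proof.
pose f t := if pselect (is_path R (expand (sval q) ++ t)) is left h
  then exist (is_path R) _ h else pnil R.
pose E := [set [::]] `|` (fun e => [:: e]) @` (@org G @^-1` [set sval (endpoint q)]).
apply: (@sub_finite_set _ _ (f @` E)).
  move=> p /= pq; have pE := core_rest p; rewrite pq in pE.
  exists (rest p); last first.
    rewrite /f; case: pselect => [h|[]]; first by apply: paths_inj.
    by rewrite -pE; exact: svalP.
  case: (rest_stub p) => [->|[e te rE]]; [by left|right].
  exists e => //=; have := svalP p; rewrite pE rE => /is_path_cat[_ [-> _]].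
  exact: embed_endpoint.
apply: finite_image; rewrite finite_setU; split; first exact: finite_set1.
by apply: finite_image; exact: locally_finite.
Qed.

Lemma core_cofinite S : cofinite_subspace S -> cofinite_subspace (core @^-1` S).
Proof.
move=> [fS uS]; split; last by move=> p q Sp /core_prefix; exact: uS.
apply: (@sub_finite_set _ _ (\bigcup_(q in ~` S) [set p | core p = q])).
  by move=> p Sp; exists (core p).
by apply: bigcup_finite => // q _; exact: core_fiber_finite.
Qed.

Lemma embed_cofinite S : cofinite_subspace S -> cofinite_subspace (embed @^-1` S).
Proof.
move=> [fS uS]; split; last by move=> p q Sp /embed_prefix; exact: uS.
apply: (@finite_preimage _ _ (~` S) embed) => //.
by move=> p q _ _ /(can_inj embedK).
Qed.

(** * Restriction to embedded paths *)

Section Restrict.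
Context (phi : aa_rep R) (hphi : is_HT phi).

Definition res_fun (q : paths Rv) : paths Rv := core (phi (embed q)).

(** [phi] preserves endpoints, so the image of an embedded path does not end at [v] and is itself
    embedded. *)
Lemma res_funE q : dom phi (embed q) -> embed (res_fun q) = phi (embed q).
Proof.
move=> dq; apply: coreK; rewrite (is_HT_tail hphi dq).1 embed_endpoint.
exact: (svalP (endpoint q)).
Qed.

Lemma res_bij : set_bij (embed @^-1` dom phi) (embed @^-1` cod phi) res_fun.
Proof.
split.
- by move=> q dq; rewrite /preimage /= res_funE //; exact: aa_funP.
- move=> p q; rewrite !inE => dp dq /(congr1 embed); rewrite !res_funE //.
  by move=> /(aa_fun_inj dp dq)/(can_inj embedK).
- move=> q /= /aa_fun_surj[p dp pq].
  have pK : embed (core p) = p.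
    by apply: coreK; rewrite -(is_HT_tail hphi dp).1 pq embed_endpoint; exact: (svalP (endpoint q)).
  by exists (core p); rewrite /= ?pK// /res_fun pK pq embedK.
Qed.

Lemma res_tail : tail_preserving (embed @^-1` dom phi) res_fun.
Proof.
move=> p dp; have [ep hp] := is_HT_tail hphi dp; split.
  have := congr1 (@endpoint _ _) (res_funE dp); rewrite ep !embed_endpoint.
  case: (endpoint _) (endpoint _) => [a aP] [b bP] /= ab; subst b.
  by rewrite (Prop_irrelevance aP bP).
move=> q r qE.
have pq : pprefix p q by apply/pprefixP; exists r.
have dq : dom phi (embed q) := dom_up dp (embed_prefix pq).
have := hp (embed q) (expand r); rewrite /= qE expand_cat => /(_ erefl).
(* Empty stubs are appended to both sides to match [expand_inj]. *)
rewrite -!res_funE //= -expand_cat -[LHS]cats0 -[RHS]cats0.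
by move=> /(expand_inj (or_introl erefl) (or_introl erefl))[].
Qed.

Definition restrict : aa_rep Rv :=
  AARep (embed_cofinite (dom_cofinite phi)) (embed_cofinite (cod_cofinite phi))
    res_bij (tail_prefix (embed_cofinite (dom_cofinite phi)) res_bij res_tail).

Lemma restrict_HT : is_HT restrict.
Proof. exact/tail_is_HT/res_tail. Qed.

End Restrict.

(** * Extension from the vanished graph *)

Section Extend.
Context (psi : aa_rep Rv) (hpsi : is_HT psi).

Definition ext_fun (p : paths R) : paths R :=
  let s := expand (sval (psi (core p))) ++ rest p in
  if pselect (is_path R s) is left h then exist (is_path R) s h else p.

(** [psi] preserves endpoints, so the stub of [p] can still follow the new core, and the default
    value [p] of [ext_fun] is not taken. *)
Lemma ext_funE p : dom psi (core p) ->
  sval (ext_fun p) = expand (sval (psi (core p))) ++ rest p.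
Proof.
move=> dp; rewrite /ext_fun; case: pselect => // -[].
apply/is_path_cat; split; first exact: (svalP (embed (psi (core p)))).
have := svalP p; rewrite core_rest => /is_path_cat[_].
rewrite -/(endpoint (embed (psi (core p)))) -/(endpoint (embed (core p))).
by rewrite !embed_endpoint (is_HT_tail hpsi dp).1.
Qed.

Lemma ext_core p : dom psi (core p) ->
  core (ext_fun p) = psi (core p) /\ rest (ext_fun p) = rest p.
Proof. by move=> dp; apply: core_unique; [exact: rest_stub|exact: ext_funE]. Qed.

Lemma ext_tail : tail_preserving (core @^-1` dom psi) ext_fun.
Proof.
move=> p dp; have [ep hp] := is_HT_tail hpsi dp; split.
  rewrite /endpoint ext_funE // [in RHS]core_rest !map_cat !last_cat.
  rewrite -/(endpoint (embed (psi (core p)))) -/(endpoint (embed (core p))).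
  by rewrite !embed_endpoint ep.
move=> q r qE; have [s cE rE] := core_cat qE.
have pq : pprefix (core p) (core q) by apply/pprefixP; exists s.
have dq : dom psi (core q) := dom_up dp pq.
by rewrite !ext_funE // (hp _ _ cE) expand_cat -!catA rE.
Qed.

End Extend.

Lemma ext_bij (psi : aa_rep Rv) : is_HT psi ->
  set_bij (core @^-1` dom psi) (core @^-1` cod psi) (ext_fun psi).
Proof.
move=> hpsi; split.
- by move=> p dp; rewrite /preimage /= (ext_core hpsi dp).1; exact: aa_funP.
- move=> p q; rewrite !inE => dp dq E; apply: paths_inj; rewrite !core_rest.
  have [cp rp] := ext_core hpsi dp; have [cq rq] := ext_core hpsi dq.
  have e : core p = core q by apply: aa_fun_inj dp dq _; rewrite -cp E cq.
  by rewrite e -rp E rq.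
(* The preimage of [q] comes from extending the inverse representative. *)
- move=> q dq; have dq' : dom (aa_inv psi) (core q) by [].
  have [/= cE rE] := ext_core (is_HT_inv hpsi) dq'.
  have [d pE] := aa_inv_funP dq.
  exists (ext_fun (aa_inv psi) q); first by rewrite /preimage /= cE.
  by apply: paths_inj; rewrite ext_funE // ?cE// pE rE -core_rest.
Qed.

Definition extend (psi : aa_rep Rv) (hpsi : is_HT psi) : aa_rep R :=
  AARep (core_cofinite (dom_cofinite psi)) (core_cofinite (cod_cofinite psi))
    (ext_bij hpsi)
    (tail_prefix (core_cofinite (dom_cofinite psi)) (ext_bij hpsi) (ext_tail hpsi)).

Lemma extend_HT psi (hpsi : is_HT psi) : is_HT (extend hpsi).
Proof. exact/tail_is_HT/ext_tail. Qed.

(** * Passage to equivalence classes *)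

Lemma restrict_extend psi (hpsi : is_HT psi) :
  aa_agree (restrict (extend_HT hpsi)) psi.
Proof.
apply: aa_eq_agree => q; rewrite ?inE /preimage /= embedK // => dq.
have dq' : dom psi (core (embed q)) by rewrite embedK.
by rewrite /res_fun /= (ext_core hpsi dq').1 embedK.
Qed.

(** Left to right gives independence of the representative, right to left injectivity: the value at
    [p] is the value at its embedded core followed by [rest p]. *)
Lemma restrict_agree (phi phi' : aa_rep R) (h : is_HT phi) (h' : is_HT phi') :
  aa_agree phi phi' <-> aa_agree (restrict h) (restrict h').
Proof.
split=> [[S [cS Sd Sd' e]]|[S [cS Sd Sd' e]]].
  exists (embed @^-1` S); split; first exact: embed_cofinite.
  - by move=> q /Sd.
  - by move=> q /Sd'.
  - by move=> q; rewrite inE => Sq; rewrite /= /res_fun e ?inE.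
have sub (p : paths R) : pprefix (embed (core p)) p.
  by apply/pprefixP; exists (rest p); exact: core_rest.
exists (core @^-1` S); split; first exact: core_cofinite.
- by move=> p /Sd /= dp; exact: dom_up dp (sub p).
- by move=> p /Sd' /= dp; exact: dom_up dp (sub p).
move=> p; rewrite inE => /= Sp; apply: paths_inj.
have d := Sd _ Sp; have d' := Sd' _ Sp.
rewrite ((is_HT_tail h d).2 p (rest p) (core_rest p)).
rewrite ((is_HT_tail h' d').2 p (rest p) (core_rest p)).
by rewrite -(res_funE h d) -(res_funE h' d'); have /= -> := e _ (mem_set Sp).
Qed.

Lemma restrict_comp (phi psi : aa_rep R) (h : is_HT phi) (k : is_HT psi) :
  aa_agree (restrict (is_HT_comp h k)) (aa_comp (restrict h) (restrict k)).
Proof.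
apply: aa_eq_agree => q; rewrite ?inE => -[/= dq dpq].
  by split=> //=; rewrite res_funE.
by rewrite /= /res_fun -/(res_fun psi q) res_funE.
Qed.

Definition HT_restrict (x : HT G R) : HT Gv Rv := HT_pi (restrict_HT (HT_rep_HT x)).

Lemma HT_restrict_pi phi (h : is_HT phi) :
  HT_restrict (HT_pi h) = HT_pi (restrict_HT h).
Proof. by apply/HT_val_inj/aa_piE/restrict_agree/HT_rep_pi. Qed.

Lemma HT_restrict_mul : {morph HT_restrict : x y / (x * y)%g}.
Proof.
move=> x y; apply: HT_val_inj; rewrite /= -[RHS]/(AAut_mul _ _) AAut_mulE.
apply/aa_piE.
apply: aa_agree_trans (restrict_comp (HT_rep_HT x) (HT_rep_HT y)).
by apply/restrict_agree/HT_rep_mul.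
Qed.

HB.instance Definition _ :=
  isMultiplicative.Build (HT G R) (HT Gv Rv) HT_restrict HT_restrict_mul.

(** Extension is checked to be a right inverse; injectivity then makes it two-sided. *)
Lemma HT_restrict_bij : bijective HT_restrict.
Proof.
pose g (y : HT Gv Rv) := HT_pi (extend_HT (HT_rep_HT y)).
have gK : cancel g HT_restrict.
  move=> y; rewrite /g HT_restrict_pi; apply: HT_val_inj; rewrite -(HT_repK y).
  exact/aa_piE/restrict_extend.
exists g => // x.
have inj : injective HT_restrict.
  move=> a b /(congr1 (@HT_val _ _))/aa_piE/restrict_agree/aa_piE.
  by rewrite !HT_repK => /HT_val_inj.
exact/inj/gK.
Qed.

End Vanishing.

Theorem theorem2 (G : graph) (R v : vertex G) (rootedR : rooted R)
    (vR : R <> v) (nl : loopless v) :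
  exists f : {multiplicative HT G R -> HT (vanish nl) (vanish_root nl vR)}, bijective f.
Proof. by exists (@HT_restrict G v nl R vR); exact: HT_restrict_bij. Qed.
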